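(* Let $q\ge1$ and let $i_1,\dots,i_q$ be integers with $1\le i_1<\cdots<i_q\le 7$. Then there exists a $9$-dimensional integral polytope $\mathcal{P}$ such that the coefficients of $t^{i_1},\dots,t^{i_q}$ in $i(\mathcal{P},t)$ are negative, and all the remaining coefficients of $i(\mathcal{P},t)$ are positive.
   Context: An integral polytope is a convex polytope all of whose vertices have integer coordinates. For an integral polytope $\mathcal{P}\subseteq\mathbb{R}^N$ of dimension $d$, $i(\mathcal{P},t)=|t\mathcal{P}\cap\mathbb{Z}^N|$ ($t$ a positive integer) is a polynomial in $t$ of degree $d$, the Ehrhart polynomial. *)

(* Defs.v *)
From mathcomp Require Import all_boot all_order all_algebra finmap.
From mathcomp Require Import boolp classical_sets cardinality reals.

Set Implicit Arguments.
Unset Strict Implicit.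
Unset Printing Implicit Defensive.

Import Order.TTheory GRing.Theory Num.Theory.

Local Open Scope classical_set_scope.
Local Open Scope ring_scope.

Definition convex_hull (R : realType) (N : nat) (S : set 'rV[R]_N) :
    set 'rV[R]_N :=
  [set x | exists (n : nat) (v : 'I_n -> 'rV[R]_N) (a : 'I_n -> R),
    [/\ forall i, S (v i), forall i, 0 <= a i, \sum_i a i = 1
      & x = \sum_i a i *: v i]].

Definition affine_hull (R : realType) (N : nat) (S : set 'rV[R]_N) :
    set 'rV[R]_N :=
  [set x | exists (n : nat) (v : 'I_n -> 'rV[R]_N) (a : 'I_n -> R),
    [/\ forall i, S (v i), \sum_i a i = 1 & x = \sum_i a i *: v i]].

Definition convex_polytope (R : realType) (N : nat) (P : set 'rV[R]_N) : Prop :=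
  exists2 V : set 'rV[R]_N, finite_set V & P = convex_hull V.

(* The vertices (zero-dimensional faces) of a polytope are its extreme
   points. *)
Definition vertex (R : realType) (N : nat) (P : set 'rV[R]_N) (x : 'rV[R]_N) :
    Prop :=
  P x /\
  forall (y z : 'rV[R]_N) (a : R), P y -> P z -> 0 < a -> a < 1 ->
    x = a *: y + (1 - a) *: z -> y = x /\ z = x.

Definition lattice (R : realType) (N : nat) : set 'rV[R]_N :=
  [set x | exists z : 'rV[int]_N, x = map_mx (fun k : int => k%:~R) z].

Definition integral_polytope (R : realType) (N : nat) (P : set 'rV[R]_N) :
    Prop :=
  convex_polytope P /\ forall x, vertex P x -> lattice x.

(* The affine hull of P is x0 plus the row space of U, which has dimension
   \rank U; in particular P is nonempty. *)
Definition has_dim (R : realType) (N : nat) (P : set 'rV[R]_N) (d : nat) :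
    Prop :=
  exists (x0 : 'rV[R]_N) (U : 'M[R]_N),
    \rank U = d /\ affine_hull P = [set x | (x - x0 <= U)%MS].

Definition dilate (R : realType) (N : nat) (t : nat) (P : set 'rV[R]_N) :
    set 'rV[R]_N :=
  [set t%:R *: x | x in P].

(* fset_set sends infinite sets to the empty one; this never occurs for a
   polytope P, which is bounded. *)
Definition ehrhart_count (R : realType) (N : nat) (P : set 'rV[R]_N)
    (t : nat) : nat :=
  #|` fset_set (dilate t P `&` @lattice R N)|.

(* Such a p is unique, since its values at infinitely many points are fixed.
   Its coefficients are rational, as it takes integer values there. *)
Definition is_ehrhart_polynomial (R : realType) (N : nat)
    (P : set 'rV[R]_N) (p : {poly rat}) : Prop :=
  forall t : nat, (0 < t)%N -> p.[t%:R] = (ehrhart_count P t)%:R.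

(* Main.v *)
Require Import Defs.
From mathcomp Require Import all_boot all_order all_algebra finmap.
From mathcomp Require Import boolp classical_sets cardinality reals.
From mathcomp Require Import ring lra zify ssrZ.

Import Order.TTheory GRing.Theory Num.Theory.

Local Open Scope classical_set_scope.
Local Open Scope ring_scope.

Set Implicit Arguments.
Unset Strict Implicit.
Unset Printing Implicit Defensive.

(** Ehrhart polynomials multiply under products of polytopes, and dilating a
    polytope by [n] substitutes [n t] for [t].  Nine-dimensional products of
    dilates of three kinds of polytopes realize all sign patterns:
    - the segment [[0, 1]], with Ehrhart polynomial [1 + t];
    - the triangle with vertices [(0, 0)], [(2, 0)], [(1, m)], with polynomial
      [1 + 2 t + m t^2]: after rescaling [t], the middle coefficient becomes
      negligible for large [m];
    - Reeve's tetrahedron with vertices [0], [e1], [e2], [(1, 1, m)], with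
      polynomial [1 + (2 - m/6) t + t^2 + (m/6) t^3], the source of negative
      coefficients. *)

(** * Weighted combinations of a finite family: hulls, vertices and dilation *)

Section Hulls.
Variables (R : realType) (d : nat).
Implicit Types (I : finType) (x : 'rV[R]_d).

(** The total weight [c] is a parameter so that [c = 1] gives the convex hull and [c = t] its
    [t]-fold dilate, with the same points [v i]. The index type is any [finType], since products of
    polytopes are indexed by pairs. *)
Definition combination I (v : I -> 'rV[R]_d) (c : R) : set 'rV[R]_d :=
  [set x | exists a : I -> R,
    [/\ forall i, 0 <= a i, \sum_i a i = c & x = \sum_i a i *: v i]].

Definition affinely_spanning I (v : I -> 'rV[R]_d) : Prop :=
  forall x, exists2 a : I -> R, \sum_i a i = 1 & x = \sum_i a i *: v i.

Lemma combination_mem I (v : I -> 'rV[R]_d) i : combination v 1 (v i).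
Proof.
exists (fun j => (j == i)%:R); split=> [j||].
- exact: ler0n.
- by rewrite (bigD1 i) //= eqxx big1 ?addr0 // => j /negPf->.
- rewrite (bigD1 i) //= eqxx scale1r big1 ?addr0 // => j /negPf->.
  by rewrite scale0r.
Qed.

Lemma convex_hull_range I (v : I -> 'rV[R]_d) :
  convex_hull (range v) = combination v 1.
Proof.
apply/seteqP; split=> x.
  move=> [n [w [b [wv b0 b1 ->]]]].
  have /choice[f fP] : forall j, exists i, v i = w j.
    by move=> j; have [i _ <-] := wv j; exists i.
  (* Several [w j] may be the same [v i]; their weights are collected in one. *)
  exists (fun i => \sum_(j | f j == i) b j); split=> [i||].
  - exact: sumr_ge0.
  - by rewrite -b1 (partition_big f xpredT).
  - rewrite (partition_big f xpredT) //=; apply: eq_bigr => i _.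
    by rewrite scaler_suml; apply: eq_bigr => j /eqP <-; rewrite fP.
move=> [a [a0 a1 ->]].
exists #|I|, (fun k => v (enum_val k)), (fun k => a (enum_val k)); split=> //.
- by rewrite -[RHS]a1 [RHS](reindex _ (onW_bij _ (@enum_val_bij I))).
- by rewrite [LHS](reindex _ (onW_bij _ (@enum_val_bij I))).
Qed.

Lemma affine_hull_spanning I (v : I -> 'rV[R]_d) :
  affinely_spanning v -> affine_hull (combination v 1) = setT.
Proof.
move=> vT; apply/seteqP; split=> // x _; have [a a1 ->] := vT x.
exists #|I|, (fun k => v (enum_val k)), (fun k => a (enum_val k)); split=> //.
- by move=> k; exact: combination_mem.
- by rewrite -[RHS]a1 [RHS](reindex _ (onW_bij _ (@enum_val_bij I))).
- by rewrite [LHS](reindex _ (onW_bij _ (@enum_val_bij I))).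
Qed.

(** Some [v i] has positive weight in [x]. If the other weights vanish, [x] is [v i]. Otherwise [x]
    lies strictly between [v i] and the renormalized combination of the other points, and
    extremality forces [v i = x]. *)
Lemma vertex_combination I (v : I -> 'rV[R]_d) x :
  vertex (combination v 1) x -> exists i, x = v i.
Proof.
move=> [[a [a0 a1 xE]] xext].
have /existsP[i ai] : [exists i, a i != 0].
  apply: contraPT a1 => /existsPn a0'; rewrite big1; last first.
    by move=> i _; apply/eqP; rewrite -[_ == _]negbK; exact: a0'.
  by move/eqP; rewrite eq_sym oner_eq0.
have ai0 : 0 < a i by rewrite lt0r ai a0.
have aiE : a i = 1 - \sum_(j | j != i) a j.
  by rewrite -a1 (bigD1 i) //= addrK.
have s0 : 0 <= \sum_(j | j != i) a j by exact: sumr_ge0.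
have [s1|sn] := eqVneq (\sum_(j | j != i) a j) 0.
  exists i; rewrite xE (bigD1 i) //= big1 => [|j ji].
    by rewrite aiE s1 subr0 scale1r addr0.
  have /eqP := s1; rewrite psumr_eq0 // => /allP/(_ j).
  by rewrite mem_index_enum ji => /(_ isT)/eqP->; rewrite scale0r.
exists i; have [] // := xext (v i)
  ((1 - a i)^-1 *: \sum_(j | j != i) a j *: v j) (a i).
- exact: combination_mem.
- have r0 : 0 <= (1 - a i)^-1 by rewrite invr_ge0 aiE; lra.
  exists (fun j => (1 - a i)^-1 * (if j == i then 0 else a j)); split=> [j||].
  + by rewrite mulr_ge0 //; case: ifP.
  + rewrite -mulr_sumr (bigD1 i) //= eqxx add0r.
    rewrite (eq_bigr a) => [|j /negPf-> //].
    by rewrite aiE opprB addrCA subrr addr0 mulVf.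
  + rewrite scaler_sumr [RHS](bigD1 i) //= eqxx mulr0 scale0r add0r.
    by apply: eq_bigr => j /negPf->; rewrite scalerA.
- by rewrite aiE ltrBlDr ltrDl lt0r sn.
- rewrite xE (bigD1 i) //= scalerA divff ?scale1r //.
  by rewrite aiE opprB addrCA subrr addr0.
Qed.

Lemma dilate_combination I (v : I -> 'rV[R]_d) (t : nat) :
  (0 < t)%N -> dilate t (combination v 1) = combination v t%:R.
Proof.
move=> t0; have tn0 : t%:R != 0 :> R by rewrite pnatr_eq0 -lt0n.
apply/seteqP; split=> x.
  move=> [_ [a [a0 a1 ->]] <-]; exists (fun i => t%:R * a i); split=> [i||].
  - by rewrite mulr_ge0 ?ler0n.
  - by rewrite -mulr_sumr a1 mulr1.
  - by rewrite scaler_sumr; apply: eq_bigr => i _; rewrite scalerA.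
move=> [a [a0 a1 xE]]; exists (t%:R^-1 *: x); last first.
  by rewrite scalerA divff ?scale1r.
exists (fun i => t%:R^-1 * a i); split=> [i||].
- by rewrite mulr_ge0 ?invr_ge0 ?ler0n.
- by rewrite -mulr_sumr a1 mulVf.
- by rewrite xE scaler_sumr; apply: eq_bigr => i _; rewrite scalerA.
Qed.

Lemma combination_mulrn I (v : I -> 'rV[R]_d) (n t : nat) x : (0 < n)%N ->
  combination (fun i => v i *+ n) t%:R x <-> combination v (n * t)%:R x.
Proof.
move=> n0; have nn0 : n%:R != 0 :> R by rewrite pnatr_eq0 -lt0n.
split=> -[a [a0 at_ ->]].
  exists (fun i => n%:R * a i); split=> [i||].
  - by rewrite mulr_ge0 ?ler0n.
  - by rewrite -mulr_sumr at_ natrM.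
  - by apply: eq_bigr => i _; rewrite -scaler_nat scalerA mulrC.
exists (fun i => n%:R^-1 * a i); split=> [i||].
- by rewrite mulr_ge0 ?invr_ge0 ?ler0n.
- by rewrite -mulr_sumr at_ natrM mulKf.
- apply: eq_bigr => i _; rewrite -scaler_nat scalerA mulrAC mulVf //.
  by rewrite mul1r.
Qed.

Lemma affinely_spanning_mulrn I (v : I -> 'rV[R]_d) (n : nat) : (0 < n)%N ->
  affinely_spanning v -> affinely_spanning (fun i => v i *+ n).
Proof.
move=> n0 vT x; have nn0 : n%:R != 0 :> R by rewrite pnatr_eq0 -lt0n.
have [a a1 xE] := vT (n%:R^-1 *: x); exists a => //.
rewrite -[LHS](scalerKV nn0) xE scaler_sumr.
by apply: eq_bigr => i _; rewrite !scalerA mulrC -scalerA scaler_nat.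
Qed.

End Hulls.

(** * Counting functions of full-dimensional lattice polytopes, and their dilation *)

Definition realvec (R : realType) d (z : 'rV[int]_d) : 'rV[R]_d :=
  map_mx (fun k : int => k%:~R) z.

(* [E t] counts the integer points of [t] times the hull of the [v i]. *)
Definition has_ehrhart (R : realType) (d : nat) (E : nat -> nat) : Prop :=
  exists (I : finType) (v : I -> 'rV[int]_d),
    affinely_spanning (fun i => realvec R (v i)) /\
    forall t : nat, (0 < t)%N -> exists s : seq 'rV[int]_d,
      [/\ uniq s, size s = E t
        & forall z, combination (fun i => realvec R (v i)) t%:R (realvec R z)
                    <-> z \in s].

Lemma realvec_inj (R : realType) d : injective (@realvec R d).
Proof.
move=> z z' /rowP e; apply/rowP => i.
by apply/eqP; rewrite -(eqr_int R); have := e i; rewrite !mxE => ->.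
Qed.

Lemma has_ehrhart_dilate (R : realType) d (E : nat -> nat) n : (0 < n)%N ->
  has_ehrhart R d E -> has_ehrhart R d (fun t => E (n * t)%N).
Proof.
move=> n0 [I [v [vT vE]]]; exists I, (fun i => v i *+ n).
have nvE i : realvec R (v i *+ n) = realvec R (v i) *+ n.
  by rewrite /realvec raddfMn.
have -> : (fun i => realvec R (v i *+ n)) = (fun i => realvec R (v i) *+ n).
  exact/funext.
split=> [|t t0]; first exact: affinely_spanning_mulrn.
have [|s [us sE vs]] := vE (n * t)%N; first by rewrite muln_gt0 n0.
by exists s; split=> // z; rewrite -vs; exact: combination_mulrn.
Qed.

(** * Products of polytopes *)

Section Product.
Variables (R : realType) (d e : nat) (I J : finType).
Variables (v : I -> 'rV[R]_d) (w : J -> 'rV[R]_e).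

Let vw (k : I * J) : 'rV[R]_(d + e) := row_mx (v k.1) (w k.2).

Lemma sum_row_mx (K : finType) (a : K -> R) (x : K -> 'rV[R]_d)
    (y : K -> 'rV[R]_e) :
  \sum_k a k *: row_mx (x k) (y k) =
  row_mx (\sum_k a k *: x k) (\sum_k a k *: y k).
Proof.
elim/big_rec3: _ => [|k x' y' z _ ->]; first by rewrite row_mx0.
by rewrite scale_row_mx add_row_mx.
Qed.

(** The weights [a i * b j / c] have marginals [a] and [b], as for a product of distributions of
    total mass [c]. The signs of the weights are left free, so the identity serves convex and affine
    combinations alike. *)
Lemma sum_pair_row_mx (a : I -> R) (b : J -> R) (c : R) : c != 0 ->
  \sum_i a i = c -> \sum_j b j = c ->
  \sum_k a k.1 * b k.2 / c = c /\
  \sum_k (a k.1 * b k.2 / c) *: vw k =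
    row_mx (\sum_i a i *: v i) (\sum_j b j *: w j).
Proof.
move=> c0 ac bc; split.
  rewrite -mulr_suml -(pair_bigA _ (fun i j => a i * b j)) /=.
  by under eq_bigr do rewrite -mulr_sumr bc; rewrite -mulr_suml ac mulfK.
rewrite sum_row_mx; congr row_mx.
  rewrite -(pair_bigA _ (fun i j => (a i * b j / c) *: v i)) /=.
  apply: eq_bigr => i _; rewrite -scaler_suml -mulr_suml -mulr_sumr bc.
  by rewrite mulfK.
rewrite -(pair_bigA _ (fun i j => (a i * b j / c) *: w j)) exchange_big /=.
apply: eq_bigr => j _; rewrite -scaler_suml -2!mulr_suml ac mulrAC divff //.
by rewrite mul1r.
Qed.

(** From left to right the weights on pairs are replaced by their two marginals; from right to left
    the product weights of [sum_pair_row_mx] are taken. *)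
Lemma combination_row_mx (c : R) x y : 0 < c ->
  combination vw c (row_mx x y) <-> combination v c x /\ combination w c y.
Proof.
move=> c0; split.
  move=> [a [a0 ac]]; rewrite sum_row_mx => /eq_row_mx[-> ->]; split.
    exists (fun i => \sum_j a (i, j)); split=> [i||]; first exact: sumr_ge0.
      by rewrite -ac pair_bigA; apply: eq_bigr => -[].
    under [RHS]eq_bigr do rewrite scaler_suml.
    by rewrite pair_bigA; apply: eq_bigr => -[].
  exists (fun j => \sum_i a (i, j)); split=> [j||]; first exact: sumr_ge0.
    by rewrite exchange_big -ac pair_bigA; apply: eq_bigr => -[].
  under [RHS]eq_bigr do rewrite scaler_suml.
  by rewrite exchange_big pair_bigA; apply: eq_bigr => -[].
move=> [[a [a0 ac ->]] [b [b0 bc ->]]].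
have [abc <-] := sum_pair_row_mx (lt0r_neq0 c0) ac bc.
exists (fun k => a k.1 * b k.2 / c); split=> // k.
by rewrite mulr_ge0 ?invr_ge0 ?(ltW c0) ?mulr_ge0.
Qed.

Lemma affinely_spanning_row_mx :
  affinely_spanning v -> affinely_spanning w -> affinely_spanning vw.
Proof.
move=> vT wT x; rewrite -[x]hsubmxK.
have [a a1 ->] := vT (lsubmx x); have [b b1 ->] := wT (rsubmx x).
have [ab1 <-] := sum_pair_row_mx (oner_neq0 R) a1 b1.
by exists (fun k => a k.1 * b k.2 / 1).
Qed.

End Product.

Lemma has_ehrhart_prod (R : realType) d e (E F : nat -> nat) :
  has_ehrhart R d E -> has_ehrhart R e F ->
  has_ehrhart R (d + e) (fun t => E t * F t)%N.
Proof.
move=> [I [v [vT vE]]] [J [w [wT wF]]].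
exists (I * J)%type, (fun k => row_mx (v k.1) (w k.2)).
have -> : (fun k : I * J => realvec R (row_mx (v k.1) (w k.2))) =
    (fun k => row_mx (realvec R (v k.1)) (realvec R (w k.2))).
  by apply/funext => k; rewrite /realvec map_row_mx.
split=> [|t t0]; first exact: (affinely_spanning_row_mx vT wT).
have [s [us sE vs]] := vE t t0; have [s' [us' sF ws']] := wF t t0.
exists [seq row_mx x y | x <- s, y <- s']; split.
- by apply: allpairs_uniq => // -[x y] [x' y'] _ _ /eq_row_mx[-> ->].
- by rewrite size_allpairs sE sF.
move=> z; rewrite -[z]hsubmxK /realvec map_row_mx.
rewrite (combination_row_mx (fun i => realvec R (v i))
  (fun j => realvec R (w j))) ?ltr0n //.
rewrite -/(realvec R _) -/(realvec R _) vs ws'.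
split=> [[zs zs']|/allpairsP[[x y] /= [xs ys' /eq_row_mx[-> ->]]] //].
by apply/allpairsP; exists (lsubmx z, rsubmx z).
Qed.

(** The empty product, which starts the induction on lists of factors. *)
Lemma has_ehrhart_point (R : realType) : has_ehrhart R 0 (fun=> 1%N).
Proof.
exists unit, (fun=> 0); split=> [x|t t0].
  exists (fun=> 1); first by rewrite sumr_const card_unit.
  by rewrite [LHS]thinmx0 [RHS]thinmx0.
exists [:: 0]; split=> // z; rewrite (thinmx0 z) mem_head; split=> // _.
exists (fun=> t%:R); split=> [i||]; first exact: ler0n.
- by rewrite sumr_const card_unit.
- by rewrite [LHS]thinmx0 [RHS]thinmx0.
Qed.

(** * Sums of column heights over the base of the triangle and the tetrahedron *)

Lemma sum_ltn (x n : nat) : (\sum_(y < n) (y < x) = minn x n)%N.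
Proof.
elim: n => [|n IHn]; first by rewrite big_ord0 minn0.
by rewrite big_ord_recr IHn /=; lia.
Qed.

(** Subtraction is truncated, so [x + y - t] stands for its positive part. Passing from [t] to
    [t + 1], the term at [y = 0] vanishes and the term at [y + 1] exceeds the old term at [y] by 1
    exactly when [y < x]; the total gain is [x]. *)
Lemma sum_reeve_row (x t : nat) : (x <= t)%N ->
  (\sum_(y < t.+1) (minn x y - (x + y - t)) = x * (t - x))%N.
Proof.
elim: t => [|t IHt]; first by move=> _; rewrite big_ord_recl big_ord0; lia.
rewrite leq_eqVlt => /predU1P[->|xt].
  by rewrite subnn muln0 big1 // => y _; lia.
rewrite big_ord_recl /= minn0 sub0n add0n.
rewrite (eq_bigr (fun y : 'I_t.+1 => minn x y - (x + y - t) + (y < x)))%N.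
  by rewrite big_split /= IHt // sum_ltn; nia.
by move=> y _; rewrite /bump /=; have := ltn_ord y; lia.
Qed.

(** The rows reduce the claim to the sum of [x * (t - x)]. Raising [t] by 1 adds the sum of all
    [x <= t], which is ['C(t.+1, 2)], and Pascal's rule concludes. *)
Lemma sum_reeve (t : nat) :
  (\sum_(x < t.+1) \sum_(y < t.+1) (minn x y - (x + y - t)) = 'C(t.+1, 3))%N.
Proof.
under eq_bigr => x _ do rewrite sum_reeve_row -1?ltnS //.
elim: t => [|t IHt]; first by rewrite big_ord_recl big_ord0.
rewrite big_ord_recr /= subnn muln0 addn0 binS -IHt -bin2_sum big_mkord.
by rewrite -big_split; apply: eq_bigr => x _ /=; have := ltn_ord x; nia.
Qed.

(** This is [sum_reeve_row] for row [t] and size [2 * t]: there the summand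
    [minn t y - (t + y - 2 * t)] equals [minn y (2 * t - y)]. *)
Lemma sum_triangle (t : nat) :
  (\sum_(x < (2 * t).+1) minn x (2 * t - x) = t ^ 2)%N.
Proof.
have := @sum_reeve_row t (2 * t)%N; rewrite leq_pmull // => /(_ isT) e.
transitivity (t * (2 * t - t))%N; last by nia.
by rewrite -e; apply: eq_bigr => x _; have := ltn_ord x; lia.
Qed.

Lemma big_iota (T : Type) (idx : T) (op : T -> T -> T) (F : nat -> T) n :
  \big[op/idx]_(x <- iota 0%N n) F x = \big[op/idx]_(x < n) F x.
Proof. by rewrite -[n in iota _ n]subn0 -/(index_iota 0 n) big_mkord. Qed.

Definition intvec d (s : seq int) : 'rV[int]_d := \row_j s`_j.

(** * Lattice point counts of the segment, the triangle and Reeve's tetrahedron *)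

Section Simplices.
Variable R : realType.

Lemma has_ehrhart_segment : has_ehrhart R 1 succn.
Proof.
exists 'I_2, (fun i : 'I_2 => const_mx i%:Z); split=> [x|t t0].
  exists (fun i : 'I_2 => [:: 1 - x 0 0; x 0 0]`_i).
    by rewrite !big_ord_recl big_ord0 /=; ring.
  apply/rowP => j; rewrite !big_ord_recl big_ord0 !ord1 !mxE -?pmulrn /=.
  by rewrite /bump /=; ring.
exists [seq const_mx k%:Z | k : nat <- iota 0 t.+1]; split.
- rewrite map_inj_uniq ?iota_uniq // => k l /rowP/(_ 0).
  by rewrite !mxE => -[].
- by rewrite size_map size_iota.
move=> z; split=> [[a [a0 at_ /rowP/(_ 0) zE]]|/mapP[k]].
  rewrite !big_ord_recl !big_ord0 !mxE -!pmulrn /= /bump /= in at_ zE.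
  have z0 : 0 <= z ord0 ord0.
    by rewrite -(ler_int R) zE; have := a0 (lift ord0 ord0); lra.
  have zt : z ord0 ord0 <= t%:Z.
    by rewrite -(ler_int R) zE -pmulrn; have := a0 ord0; lra.
  apply/mapP; exists `|z ord0 ord0|%N; first by rewrite mem_iota; lia.
  by apply/rowP => j; rewrite ord1 mxE gez0_abs.
rewrite mem_iota => /andP[_ kt] ->; rewrite add0n ltnS -(ler_nat R) in kt.
exists (fun i : 'I_2 => [:: t%:R - k%:R; k%:R]`_i); split.
- by case=> -[|[|//]] ? /=; rewrite ?subr_ge0 ?ler0n.
- by rewrite !big_ord_recl big_ord0 /=; ring.
- apply/rowP => j; rewrite !big_ord_recl big_ord0 !ord1 !mxE -!pmulrn /=.
  by rewrite /bump /=; ring.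
Qed.

Definition triangle (m : nat) (i : 'I_3) : 'rV[int]_2 :=
  intvec 2 (nth [::] [:: [:: 0; 0]; [:: 2; 0]; [:: 1; m%:Z]] i).

Definition reeve (m : nat) (i : 'I_4) : 'rV[int]_3 :=
  intvec 3
    (nth [::] [:: [:: 0; 0; 0]; [:: 1; 0; 0]; [:: 0; 1; 0]; [:: 1; 1; m%:Z]] i).

(** Barycentric coordinates scaled to total [c], found by solving for the weight [b] of the apex
    first. They exist for every [x], which gives affine spanning; listing their values leaves only
    sign checks for membership in a dilate. *)
Lemma triangle_coords m (c : R) (x : 'rV[R]_2) : (0 < m)%N ->
  let b := x 0 1 / m%:R in
  exists2 a : 'I_3 -> R, \sum_i a i = c /\
      x = \sum_i a i *: realvec R (triangle m i)
    & forall i, a i \in [:: c - (x 0 0 + b) / 2; (x 0 0 - b) / 2; b].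
Proof.
move=> m0 b; have mR : m%:R != 0 :> R by rewrite pnatr_eq0 -lt0n.
exists (fun i : 'I_3 => [:: c - (x 0 0 + b) / 2; (x 0 0 - b) / 2; b]`_i).
  split; first by rewrite !big_ord_recl big_ord0 /=; field.
  apply/rowP => j; rewrite !big_ord_recl big_ord0 !mxE -?pmulrn.
  case: j => -[|[|//]] j2 /=.
    rewrite [x _ _](_ : _ = x 0 0); last by congr (x _ _); exact/val_inj.
    by rewrite -?pmulrn /=; field.
  rewrite [x _ _](_ : _ = x 0 1); last by congr (x _ _); exact/val_inj.
  by rewrite -?pmulrn /b; field.
by move=> i; rewrite mem_nth.
Qed.

Lemma reeve_coords m (c : R) (x : 'rV[R]_3) : (0 < m)%N ->
  let b := x 0 2 / m%:R in
  exists2 a : 'I_4 -> R, \sum_i a i = c /\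
      x = \sum_i a i *: realvec R (reeve m i)
    & forall i, a i \in [:: c + b - x 0 0 - x 0 1; x 0 0 - b; x 0 1 - b; b].
Proof.
move=> m0 b; have mR : m%:R != 0 :> R by rewrite pnatr_eq0 -lt0n.
exists (fun i : 'I_4 =>
  [:: c + b - x 0 0 - x 0 1; x 0 0 - b; x 0 1 - b; b]`_i).
  split; first by rewrite !big_ord_recl big_ord0 /=; ring.
  apply/rowP => j; rewrite !big_ord_recl big_ord0 !mxE -?pmulrn.
  case: j => -[|[|[|//]]] j3 /=.
  - rewrite [x _ _](_ : _ = x 0 0); last by congr (x _ _); exact/val_inj.
    by rewrite -?pmulrn /=; ring.
  - rewrite [x _ _](_ : _ = x 0 1); last by congr (x _ _); exact/val_inj.
    by rewrite -?pmulrn /=; ring.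
  - rewrite [x _ _](_ : _ = x 0 2); last by congr (x _ _); exact/val_inj.
    by rewrite -?pmulrn /b; field.
by move=> i; rewrite mem_nth.
Qed.

(** The inequalities say that the three barycentric coordinates are nonnegative, with denominators
    cleared; being integral, they can be handled by integer arithmetic. *)
Lemma combination_triangle m (t : nat) (z : 'rV[int]_2) : (0 < m)%N ->
  combination (fun i => realvec R (triangle m i)) t%:R (realvec R z) <->
  [/\ 0 <= z 0 1, z 0 1 <= m%:Z * z 0 0
    & z 0 1 <= m%:Z * (2 * t%:Z - z 0 0)].
Proof.
move=> m0; have mR : 0 < m%:R :> R by rewrite ltr0n.
split=> [[a [a0 at_ /rowP zE]]|[z1 zm zt]].
  have [a1 a2 a3] : [/\ 0 <= a ord0, 0 <= a (lift ord0 ord0)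
    & 0 <= a (lift ord0 (lift ord0 ord0))] by [].
  have := zE 0; have := zE 1; rewrite !big_ord_recl !big_ord0 !mxE in at_ *.
  rewrite /= -?pmulrn => z1 z0.
  split; rewrite -(ler_int R) ?intrM ?intrB ?intrM z1 ?z0 -?pmulrn; nra.
have [a [aE zE] a0] := triangle_coords t%:R (realvec R z) m0.
exists a; split=> // i; move: (a0 i); rewrite !inE !mxE.
move: z1 zm zt; rewrite -!(ler_int R) !intrM intrB intrM -!pmulrn.
set z0 := (z 0 0)%:~R; set z1 := (z 0 1)%:~R => z10 zm zt.
have b0 : 0 <= z1 / m%:R by rewrite divr_ge0 // ltW.
have bm : z1 / m%:R <= z0 by rewrite ler_pdivrMr // mulrC.
have bt : z1 / m%:R <= 2 * t%:R - z0 by rewrite ler_pdivrMr // mulrC.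
by case/or3P => /eqP->; lra.
Qed.

Lemma combination_reeve m (t : nat) (z : 'rV[int]_3) : (0 < m)%N ->
  combination (fun i => realvec R (reeve m i)) t%:R (realvec R z) <->
  [/\ 0 <= z 0 2, z 0 2 <= m%:Z * z 0 0, z 0 2 <= m%:Z * z 0 1
    & m%:Z * (z 0 0 + z 0 1 - t%:Z) <= z 0 2].
Proof.
move=> m0; have mR : 0 < m%:R :> R by rewrite ltr0n.
split=> [[a [a0 at_ /rowP zE]]|[z20 z2x z2y zt]].
  have [a1 a2 a3 a4] : [/\ 0 <= a ord0, 0 <= a (lift ord0 ord0),
    0 <= a (lift ord0 (lift ord0 ord0))
    & 0 <= a (lift ord0 (lift ord0 (lift ord0 ord0)))] by [].
  have := zE 0; have := zE 1; have := zE 2.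
  rewrite !big_ord_recl !big_ord0 !mxE in at_ *.
  rewrite /= -?pmulrn => z2 z1 z0.
  split; rewrite -(ler_int R) ?intrM ?intrB ?intrD z2 ?z1 ?z0 -?pmulrn; nra.
have [a [aE zE] a0] := reeve_coords t%:R (realvec R z) m0.
exists a; split=> // i; move: (a0 i); rewrite !inE !mxE.
move: z20 z2x z2y zt; rewrite -!(ler_int R) !intrM intrB intrD -!pmulrn.
set z0 := (z 0 0)%:~R; set z1 := (z 0 1)%:~R; set z2 := (z 0 2)%:~R.
move=> z20 z2x z2y zt.
have b0 : 0 <= z2 / m%:R by rewrite divr_ge0 // ltW.
have bx : z2 / m%:R <= z0 by rewrite ler_pdivrMr // mulrC.
have by_ : z2 / m%:R <= z1 by rewrite ler_pdivrMr // mulrC.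
have bt : z0 + z1 - t%:R <= z2 / m%:R by rewrite ler_pdivlMr // mulrC.
by case/or4P => /eqP->; lra.
Qed.

(** Over each abscissa [x] from 0 to [2 * t] the integer points are the heights from 0 to
    [m * minn x (2 * t - x)]; [sum_triangle] adds up the columns. *)
Lemma has_ehrhart_triangle m : (0 < m)%N ->
  has_ehrhart R 2 (fun t => (2 * t).+1 + m * t ^ 2)%N.
Proof.
move=> m0; exists 'I_3, (triangle m); split=> [x|t t0].
  by have [a []] := triangle_coords 1 x m0; exists a.
exists [seq intvec 2 [:: x%:Z; k%:Z]
       | x <- iota 0 (2 * t).+1,
         k <- iota 0 (m * minn x (2 * t - x)).+1]; split.
- apply: allpairs_uniq_dep => [||[x k] [y l] _ _ /rowP e].
  + exact: iota_uniq.
  + by move=> *; exact: iota_uniq.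
  + by have := e 0; have := e 1; rewrite !mxE /= => -[->] [->].
- rewrite size_allpairs_dep -sum_triangle big_distrr sumnE big_map big_iota.
  rewrite (eq_bigr (fun x : 'I_ _ => m * minn x (2 * t - x) + 1)%N).
    by rewrite big_split /= sum_nat_const card_ord muln1 addnC.
  by move=> x _; rewrite size_iota addn1.
move=> z; rewrite combination_triangle //.
split=> [[]|/allpairsPdep[x [k []]]]; last first.
  rewrite !mem_iota minnMr !add0n !ltnS leq_min => xt /and3P[_ kx kt] ->.
  rewrite !mxE /=; split; nia.
move e0: (z 0 0) => z0; move e1: (z 0 1) => z1 z10 zx zt.
have [x x0] : exists x : nat, z0 = x%:Z by exists `|z0|%N; nia.
have [k k0] : exists k : nat, z1 = k%:Z by exists `|z1|%N; lia.
apply/allpairsPdep; exists x, k; split.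
- by rewrite mem_iota; nia.
- rewrite mem_iota minnMr add0n ltnS leq_min; apply/and3P; split=> //; nia.
apply/rowP => j; rewrite !mxE; case: j => -[|[|//]] j2 /=.
  by rewrite -x0 -e0; congr (z _ _); exact/val_inj.
by rewrite -k0 -e1; congr (z _ _); exact/val_inj.
Qed.

(* The integer points of the [t]-fold dilate over [(x, y)] are the [k] with
   [m (x + y - t)^+ <= k <= m min(x, y)]. *)
Lemma has_ehrhart_reeve m : (0 < m)%N ->
  has_ehrhart R 3 (fun t => t.+1 ^ 2 + m * 'C(t.+1, 3))%N.
Proof.
move=> m0; exists 'I_4, (reeve m); split=> [x|t t0].
  by have [a []] := reeve_coords 1 x m0; exists a.
pose height (p : nat * nat) := (minn p.1 p.2 - (p.1 + p.2 - t))%N.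
exists [seq intvec 3 [:: p.1%:Z; p.2%:Z; k%:Z]
       | p <- [seq (x, y) | x <- iota 0 t.+1, y <- iota 0 t.+1],
         k <- iota (m * (p.1 + p.2 - t)) (m * height p).+1]; split.
- apply: allpairs_uniq_dep => [||[[x y] k] [[x' y'] l] _ _ /rowP e].
  + by apply: allpairs_uniq; rewrite ?iota_uniq // => -[? ?] [].
  + by move=> *; exact: iota_uniq.
  + have := e 0; have := e 1; have := e 2.
    by rewrite !mxE /= => -[->] [->] [->].
(* Each column has [m * height + 1] points: the ones add up to [t.+1 ^ 2], the heights to the
   binomial. *)
- rewrite size_allpairs_dep -sum_reeve sumnE big_map big_allpairs big_iota.
  rewrite big_distrr -[(t.+1 ^ 2)%N]mulnn -[X in (X * _ + _)%N]card_ord.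
  rewrite -sum_nat_const -big_split; apply: eq_bigr => x _.
  rewrite big_iota big_distrr -[RHS]/(t.+1 + _)%N.
  rewrite -[X in (X + _)%N]card_ord -sum1_card.
  by rewrite -big_split; apply: eq_bigr => y _; rewrite size_iota.
move=> z; rewrite combination_reeve //.
split=> [[]|/allpairsPdep[[x y] [k []]]]; last first.
  move=> /allpairsP[[x' y'] [xt yt [-> ->]]].
  move: xt yt; rewrite !mem_iota /height /= => xt yt kxy ->.
  rewrite !mxE /=; split; nia.
move e0: (z 0 0) => z0; move e1: (z 0 1) => z1; move e2: (z 0 2) => z2.
move=> z20 zx zy zt.
have [k k0] : exists k : nat, z2 = k%:Z by exists `|z2|%N; lia.
have [x x0] : exists x : nat, z0 = x%:Z by exists `|z0|%N; nia.
have [y y0] : exists y : nat, z1 = y%:Z by exists `|z1|%N; nia.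
(* The bounds [m * (x + y - t) <= k <= m * y] give [x <= t]; symmetrically for [y]. *)
have xt : (x <= t)%N by nia.
have yt : (y <= t)%N by nia.
apply/allpairsPdep; exists (x, y), k; split.
- by apply/allpairsP; exists (x, y); rewrite !mem_iota; split=> //; lia.
- rewrite mem_iota /height /=; nia.
apply/rowP => j; rewrite !mxE; case: j => -[|[|[|//]]] j3 /=.
- by rewrite -x0 -e0; congr (z _ _); exact/val_inj.
- by rewrite -y0 -e1; congr (z _ _); exact/val_inj.
by rewrite -k0 -e2; congr (z _ _); exact/val_inj.
Qed.

End Simplices.

(** * Products of dilated blocks and the computation of their coefficients *)

Inductive block := Segment of nat | Triangle of nat & nat | Reeve of nat & nat.

Definition block_dim (b : block) : nat :=
  match b with Segment _ => 1 | Triangle _ _ => 2 | Reeve _ _ => 3 end.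

Definition block_valid (b : block) : bool :=
  match b with
  | Segment n => (0 < n)%N
  | Triangle m n | Reeve m n => (0 < m)%N && (0 < n)%N
  end.

(** The last argument [n] of a block is its dilation factor, so [n * t] replaces [t]; the first
    argument [m] of [Triangle] and [Reeve] is the height parameter. *)
Definition block_count (b : block) (t : nat) : nat :=
  match b with
  | Segment n => (n * t).+1%N
  | Triangle m n => ((2 * (n * t)).+1 + m * (n * t) ^ 2)%N
  | Reeve m n => ((n * t).+1 ^ 2 + m * 'C((n * t).+1, 3))%N
  end.

(* The factor 6 clears the denominators of the Ehrhart polynomial. *)
Definition block_coefs (A : pzRingType) (b : block) : seq A :=
  match b with
  | Segment n => [:: 6; 6 * n%:R]
  | Triangle m n => [:: 6; 12 * n%:R; 6 * m%:R * n%:R ^+ 2]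
  | Reeve m n => [:: 6; (12 - m%:R) * n%:R; 6 * n%:R ^+ 2; m%:R * n%:R ^+ 3]
  end.

(** Polynomial arithmetic on plain coefficient lists, which reduces by evaluation. The ring is a
    parameter: signs are computed over binary integers, the Ehrhart polynomial lives over the
    rationals. *)
Fixpoint coefs_add (A : pzRingType) (s t : seq A) : seq A :=
  match s, t with
  | [::], _ => t
  | _, [::] => s
  | a :: s', b :: t' => a + b :: coefs_add s' t'
  end.

Fixpoint coefs_mul (A : pzRingType) (s t : seq A) : seq A :=
  if s is a :: s' then coefs_add [seq a * b | b <- t] (0 :: coefs_mul s' t)
  else [::].

Definition blocks_coefs (A : pzRingType) (bs : seq block) : seq A :=
  foldr (fun b s => coefs_mul (block_coefs A b) s) [:: 1] bs.

Lemma Poly_coefs_add (A : nzRingType) (s t : seq A) :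
  Poly (coefs_add s t) = Poly s + Poly t.
Proof.
elim: s t => [|a s IHs] [|b t] /=; rewrite ?(add0r, addr0) //.
by rewrite !cons_poly_def IHs polyCD mulrDl addrACA.
Qed.

Lemma Poly_coefs_mul (A : comNzRingType) (s t : seq A) :
  Poly (coefs_mul s t) = Poly s * Poly t.
Proof.
elim: s => [|a s IHs] /=; first by rewrite mul0r.
rewrite Poly_coefs_add /= !cons_poly_def IHs addr0 mulrDl addrC mulrAC.
congr (_ + _); elim: t {IHs} => [|b t IHt] /=; first by rewrite mulr0.
by rewrite !cons_poly_def IHt polyCM mulrDr mulrA.
Qed.

Lemma Poly_blocks_coefs (A : comNzRingType) (bs : seq block) :
  Poly (blocks_coefs A bs) = \prod_(b <- bs) Poly (block_coefs A b).
Proof.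
elim: bs => [|b bs IHbs]; first by rewrite big_nil /= cons_poly_def mul0r add0r.
by rewrite big_cons /= Poly_coefs_mul IHbs.
Qed.

(** Transfers the coefficients computed over [BinNums.Z] to the rationals. *)
Lemma map_blocks_coefs (A B : pzRingType) (f : {rmorphism A -> B}) bs :
  map f (blocks_coefs A bs) = blocks_coefs B bs.
Proof.
have fD s t : map f (coefs_add s t) = coefs_add (map f s) (map f t).
  by elim: s t => [|a s IHs] [|b t] //=; rewrite rmorphD IHs.
have fM s t : map f (coefs_mul s t) = coefs_mul (map f s) (map f t).
  elim: s => //= a s IHs; rewrite fD /= rmorph0 IHs -!map_comp.
  by congr coefs_add; apply: eq_map => b /=; rewrite rmorphM.
elim: bs => [|b bs IHbs] /=; first by rewrite rmorph1.
rewrite fM IHbs; congr coefs_mul.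
by case: b => [n|m n|m n] /=; rewrite !(rmorphM, rmorphXn, rmorphB, rmorph_nat).
Qed.

Lemma horner_block_coefs b (t : nat) :
  (Poly (block_coefs rat b)).[t%:R] = 6 * (block_count b t)%:R.
Proof.
rewrite horner_Poly; case: b => [n|m n|m n] /=.
- by ring.
- by ring.
(* With [k = n * t] this is [k ^ 3 - k], the source of the term [- m] in the linear coefficient of
   [Reeve m n]. *)
have bin6 k : 6 * 'C(k.+1, 3)%:R = (k.+1%:R * k%:R * (k%:R - 1) : rat).
  case: k => [|k]; first by rewrite bin_small // !mulr0 mul0r.
  rewrite -[6]/(3`!%:R) -natrM mulnC bin_ffact !ffactnS ffactn0 /= muln1.
  by ring.
rewrite natrD mulrDr [(m * 'C(_, _))%:R]natrM [6 * (m%:R * _)]mulrCA bin6.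
by ring.
Qed.

Lemma has_ehrhart_blocks (R : realType) (bs : seq block) :
  all block_valid bs ->
  has_ehrhart R (sumn (map block_dim bs))
    (fun t => \prod_(b <- bs) block_count b t)%N.
Proof.
elim: bs => [_|b bs IHbs /= /andP[bv /IHbs bsE]].
  suff -> : (fun t => \prod_(b <- [::]) block_count b t)%N = (fun=> 1%N).
    exact: has_ehrhart_point.
  by apply/funext => t; rewrite big_nil.
have -> : (fun t => \prod_(b <- b :: bs) block_count b t)%N =
    (fun t => block_count b t * \prod_(b <- bs) block_count b t)%N.
  by apply/funext => t; rewrite big_cons.
apply: has_ehrhart_prod bsE.
case: b bv => [n n0|m n /andP[m0 n0]|m n /andP[m0 n0]].
- exact: has_ehrhart_dilate n0 (has_ehrhart_segment R).
- exact: has_ehrhart_dilate n0 (has_ehrhart_triangle R m0).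
- exact: has_ehrhart_dilate n0 (has_ehrhart_reeve R m0).
Qed.

(** Every vertex is one of the integral points [v i], and affine spanning makes the affine hull the
    whole space, the row space of the identity. *)
Lemma ehrhart_polytope (R : realType) d (E : nat -> nat) : has_ehrhart R d E ->
  exists P : set 'rV[R]_d, [/\ integral_polytope P, has_dim P d
    & forall t, (0 < t)%N -> ehrhart_count P t = E t].
Proof.
move=> [I [v [vT vE]]].
exists (combination (fun i => realvec R (v i)) 1); split.
- split.
    exists (range (fun i => realvec R (v i))).
      exact: finite_image finite_finset.
    by rewrite convex_hull_range.
  by move=> x /vertex_combination[i ->]; exists (v i).
- exists 0, 1%:M; split; first exact: mxrank1.
  rewrite affine_hull_spanning //; apply/seteqP; split=> // x _ /=.
  exact: submx1.
move=> t t0; have [s [us <- vs]] := vE t t0.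
rewrite /ehrhart_count dilate_combination //.
rewrite -(size_map (@realvec R d)).
(* Presenting the set as the elements of a finite list keeps [fset_set] away from its default
   value. *)
have -> : combination (fun i => realvec R (v i)) t%:R `&` @lattice R d =
    [set` [fset x in map (@realvec R d) s]%fset].
  apply/seteqP; split=> x /=.
    move=> [xv [z xz]]; rewrite in_fset /= xz; apply/mapP; exists z => //.
    by apply/vs; rewrite /realvec -xz.
  rewrite in_fset => /mapP[z zs ->]; split; last by exists z.
  exact/vs.
rewrite set_fsetK card_fseq undup_id // map_inj_uniq //; exact: realvec_inj.
Qed.

(** Each block contributes one factor 6, so the polynomial is the computed product divided by
    [6 ^ size bs]; this positive scalar preserves all signs. *)
Lemma ehrhart_polynomial_blocks (R : realType) (bs : seq block) :
  all block_valid bs ->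
  let d := sumn (map block_dim bs) in
  exists (P : set 'rV[R]_d) (p : {poly rat}),
    [/\ integral_polytope P, has_dim P d, is_ehrhart_polynomial P p,
        forall k, (p`_k < 0) = ((blocks_coefs BinNums.Z bs)`_k < 0)
      & forall k, (0 < p`_k) = (0 < (blocks_coefs BinNums.Z bs)`_k)].
Proof.
move=> bsv d; have [P [Pint Pdim PE]] :=
  ehrhart_polytope (has_ehrhart_blocks R bsv).
have c0 : 0 < 6^-1 ^+ size bs :> rat by rewrite exprn_gt0.
have coefE k : (6^-1 ^+ size bs *: Poly (blocks_coefs rat bs))`_k =
    6^-1 ^+ size bs * (int_of_Z (blocks_coefs BinNums.Z bs)`_k)%:~R.
  have [ks|ks] := ltnP k (size (blocks_coefs BinNums.Z bs)).
    rewrite coefZ coef_Poly -(map_blocks_coefs (intr \o int_of_Z)).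
    by rewrite (nth_map 0).
  rewrite coefZ coef_Poly -(map_blocks_coefs (intr \o int_of_Z)).
  by rewrite !nth_default ?size_map.
exists P, (6^-1 ^+ size bs *: Poly (blocks_coefs rat bs)).
split=> // [t t0|k|k].
- rewrite PE // hornerZ Poly_blocks_coefs horner_prod.
  under eq_bigr do rewrite horner_block_coefs.
  rewrite big_split /= big_const_seq count_predT iter_mulr_1 mulrA -exprMn.
  by rewrite mulVf // expr1n mul1r natr_prod.
- by rewrite coefE pmulr_rlt0 // ltrz0; lia.
- by rewrite coefE pmulr_rgt0 // ltr0z; lia.
Qed.

(** * The table of sign patterns, its verification and the conclusion *)

Fixpoint bool_seqs (n : nat) : seq (seq bool) :=
  if n is n'.+1 then [seq b :: s | b <- [:: true; false], s <- bool_seqs n']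
  else [:: [::]].

Lemma mem_bool_seqs s : s \in bool_seqs (size s).
Proof.
elim: s => // b s IHs.
by apply: (allpairs_f cons) => //; case: b.
Qed.

(* Found by a numerical search, one row for each sign pattern. *)
Definition sign_table : seq (seq block) := [::
  [:: Reeve 1 1; Reeve 1 1; Reeve 1 1];
  [:: Reeve 13 10; Reeve 13 1; Reeve 2 1];
  [:: Reeve 16 4; Reeve 15 1; Triangle 1 1; Segment 12];
  [:: Reeve 15 7; Reeve 15 1; Triangle 9 9; Segment 1];
  [:: Reeve 13 1; Reeve 12 1; Reeve 11 11];
  [:: Reeve 17 6; Triangle 13 10; Triangle 11 9; Triangle 2 1];
  [:: Reeve 17 2; Reeve 16 8; Triangle 8 4; Segment 1];
  [:: Reeve 13 1; Reeve 11 9; Reeve 8 10];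
  [:: Reeve 19 5; Reeve 14 1; Triangle 1 1; Segment 4];
  [:: Reeve 19 2; Reeve 17 1; Triangle 18 1; Segment 1];
  [:: Reeve 13 9; Reeve 13 1; Reeve 12 1];
  [:: Reeve 19 1; Reeve 19 1; Reeve 1 1];
  [:: Reeve 19 10; Reeve 19 1; Triangle 1 5; Segment 1];
  [:: Reeve 14 6; Reeve 14 1; Reeve 9 4];
  [:: Reeve 22 2; Reeve 17 1; Reeve 1 6];
  [:: Reeve 24 2; Reeve 4 1; Triangle 17 1; Segment 24];
  [:: Reeve 19 2; Reeve 19 2; Reeve 1 3];
  [:: Reeve 18 8; Reeve 18 2; Triangle 1 9; Segment 1];
  [:: Reeve 18 5; Reeve 15 1; Triangle 15 1; Segment 13];
  [:: Reeve 21 2; Reeve 1 1; Triangle 6 8; Segment 1];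
  [:: Reeve 23 3; Triangle 22 1; Triangle 20 1; Triangle 17 6];
  [:: Reeve 16 9; Reeve 15 4; Triangle 5 15; Segment 1];
  [:: Reeve 17 4; Reeve 15 1; Triangle 16 6; Segment 3];
  [:: Reeve 21 1; Reeve 10 11; Reeve 3 1];
  [:: Reeve 23 2; Reeve 10 19; Triangle 18 1; Segment 1];
  [:: Reeve 14 2; Reeve 14 1; Reeve 7 9];
  [:: Reeve 21 2; Triangle 19 14; Triangle 18 14; Triangle 1 1];
  [:: Reeve 20 2; Triangle 16 1; Triangle 14 6; Triangle 10 10];
  [:: Reeve 21 1; Reeve 16 3; Triangle 1 9; Segment 2];
  [:: Reeve 25 8; Reeve 18 2; Triangle 3 8; Segment 3];
  [:: Reeve 23 1; Reeve 23 1; Reeve 4 2];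
  [:: Reeve 19 2; Reeve 19 2; Triangle 1 1; Segment 2];
  [:: Reeve 20 16; Reeve 19 1; Triangle 1 8; Segment 1];
  [:: Reeve 20 9; Reeve 17 1; Reeve 2 7];
  [:: Reeve 27 3; Reeve 1 1; Triangle 24 2; Segment 1];
  [:: Reeve 26 14; Triangle 20 8; Triangle 18 7; Triangle 1 1];
  [:: Reeve 19 2; Reeve 19 1; Triangle 18 1; Segment 1];
  [:: Reeve 20 17; Reeve 15 1; Triangle 12 10; Segment 3];
  [:: Reeve 20 20; Reeve 20 4; Reeve 1 3];
  [:: Reeve 22 2; Reeve 19 16; Triangle 16 1; Segment 1];
  [:: Reeve 15 2; Reeve 15 1; Reeve 10 4];
  [:: Reeve 22 3; Reeve 19 15; Triangle 1 7; Segment 1];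
  [:: Reeve 23 2; Reeve 21 22; Triangle 14 1; Segment 13];
  [:: Reeve 20 1; Reeve 19 9; Triangle 17 4; Segment 1];
  [:: Reeve 27 2; Reeve 14 1; Reeve 2 8];
  [:: Reeve 29 6; Reeve 6 12; Triangle 1 1; Segment 22];
  [:: Reeve 21 1; Reeve 20 1; Reeve 1 4];
  [:: Reeve 22 3; Reeve 20 1; Reeve 1 9];
  [:: Reeve 25 4; Reeve 25 4; Triangle 22 1; Segment 16];
  [:: Reeve 30 2; Reeve 12 3; Triangle 5 2; Segment 5];
  [:: Reeve 20 2; Reeve 14 1; Triangle 18 1; Segment 18];
  [:: Reeve 21 3; Reeve 19 5; Triangle 1 8; Segment 1];
  [:: Reeve 23 2; Reeve 21 9; Triangle 17 1; Segment 18];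
  [:: Reeve 22 1; Reeve 21 1; Reeve 2 4];
  [:: Reeve 27 2; Triangle 7 1; Triangle 5 1; Triangle 3 23];
  [:: Reeve 26 1; Reeve 13 1; Triangle 18 7; Segment 1];
  [:: Reeve 20 1; Reeve 16 1; Triangle 3 7; Segment 2];
  [:: Reeve 30 1; Reeve 8 2; Reeve 1 4];
  [:: Reeve 26 2; Triangle 22 1; Triangle 20 1; Triangle 9 10];
  [:: Reeve 20 1; Reeve 20 1; Triangle 19 3; Segment 1];
  [:: Reeve 27 4; Reeve 9 13; Triangle 4 4; Segment 1];
  [:: Reeve 26 1; Reeve 9 12; Reeve 5 2];
  [:: Reeve 22 2; Reeve 22 2; Reeve 2 12];
  [:: Reeve 25 1; Triangle 17 15; Triangle 10 10; Triangle 3 1];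
  [:: Reeve 29 2; Reeve 9 1; Triangle 16 1; Segment 3];
  [:: Reeve 33 12; Reeve 10 15; Reeve 1 19];
  [:: Reeve 25 2; Reeve 24 3; Triangle 3 4; Segment 2];
  [:: Reeve 25 8; Reeve 17 1; Triangle 3 8; Segment 2];
  [:: Reeve 23 1; Reeve 22 1; Reeve 1 1];
  [:: Reeve 25 3; Reeve 24 3; Triangle 18 1; Segment 5];
  [:: Reeve 24 1; Reeve 23 1; Reeve 4 2];
  [:: Reeve 22 1; Reeve 22 1; Triangle 2 1; Segment 1];
  [:: Reeve 23 2; Reeve 21 11; Triangle 17 1; Segment 12];
  [:: Reeve 22 8; Reeve 22 1; Reeve 1 8];
  [:: Reeve 31 2; Triangle 24 1; Triangle 8 1; Triangle 7 1];
  [:: Reeve 28 3; Reeve 14 4; Triangle 27 1; Segment 1];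
  [:: Reeve 21 1; Reeve 20 1; Reeve 19 1];
  [:: Reeve 25 5; Reeve 22 5; Triangle 3 7; Segment 1];
  [:: Reeve 31 2; Triangle 29 1; Triangle 28 1; Triangle 23 1];
  [:: Reeve 21 1; Reeve 20 7; Triangle 18 3; Segment 1];
  [:: Reeve 25 4; Reeve 23 10; Triangle 5 3; Segment 1];
  [:: Reeve 26 1; Reeve 15 6; Reeve 5 2];
  [:: Reeve 25 1; Reeve 24 1; Reeve 5 2];
  [:: Reeve 26 1; Reeve 21 4; Reeve 3 3];
  [:: Reeve 29 6; Reeve 5 14; Triangle 1 1; Segment 19];
  [:: Reeve 31 1; Reeve 15 1; Reeve 2 4];
  [:: Reeve 26 2; Reeve 17 1; Reeve 2 8];
  [:: Reeve 23 2; Reeve 22 2; Triangle 1 6; Segment 1];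
  [:: Reeve 126 3; Reeve 17 2; Triangle 9 1; Segment 105];
  [:: Reeve 22 3; Reeve 21 1; Reeve 1 9];
  [:: Reeve 30 2; Reeve 14 4; Triangle 15 1; Segment 6];
  [:: Reeve 25 3; Reeve 25 3; Triangle 18 1; Segment 16];
  [:: Reeve 23 1; Reeve 23 1; Reeve 3 4];
  [:: Reeve 26 1; Reeve 18 3; Triangle 4 1; Segment 7];
  [:: Reeve 30 2; Reeve 7 4; Reeve 1 11];
  [:: Reeve 33 2; Triangle 21 1; Triangle 9 2; Triangle 3 5];
  [:: Reeve 20 1; Reeve 20 1; Triangle 3 5; Segment 2];
  [:: Reeve 33 1; Triangle 13 1; Triangle 8 1; Triangle 7 1];
  [:: Reeve 29 2; Reeve 5 5; Triangle 6 8; Segment 8];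
  [:: Reeve 32 2; Reeve 11 3; Triangle 3 2; Segment 1];
  [:: Reeve 32 2; Reeve 13 3; Triangle 5 2; Segment 3];
  [:: Reeve 28 2; Reeve 17 1; Triangle 18 1; Segment 4];
  [:: Reeve 26 2; Reeve 25 3; Triangle 2 5; Segment 1];
  [:: Reeve 128 3; Reeve 17 2; Triangle 9 1; Segment 52];
  [:: Reeve 25 1; Reeve 24 1; Triangle 6 1; Segment 2];
  [:: Reeve 25 3; Reeve 25 3; Triangle 16 1; Segment 5];
  [:: Reeve 25 3; Reeve 25 3; Triangle 17 1; Segment 9];
  [:: Reeve 25 1; Reeve 23 1; Reeve 4 2];
  [:: Reeve 26 1; Reeve 23 4; Reeve 3 3];
  [:: Reeve 32 2; Reeve 10 4; Triangle 5 2; Segment 1];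
  [:: Reeve 37 2; Triangle 22 1; Triangle 21 1; Triangle 10 2];
  [:: Reeve 23 3; Reeve 22 3; Triangle 23 2; Segment 6];
  [:: Reeve 35 2; Reeve 20 5; Triangle 3 5; Segment 2];
  [:: Reeve 29 1; Reeve 23 2; Reeve 5 2];
  [:: Reeve 32 4; Reeve 10 7; Reeve 2 13];
  [:: Reeve 34 3; Reeve 9 5; Reeve 4 10];
  [:: Reeve 25 1; Reeve 21 1; Reeve 2 5];
  [:: Reeve 31 1; Reeve 30 1; Triangle 1 2; Segment 3];
  [:: Reeve 27 3; Reeve 26 3; Triangle 16 1; Segment 13];
  [:: Reeve 33 1; Reeve 10 2; Reeve 2 5];
  [:: Reeve 32 2; Reeve 12 3; Triangle 4 2; Segment 2];
  [:: Reeve 35 11; Reeve 8 19; Reeve 6 27];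
  [:: Reeve 28 1; Reeve 27 1; Triangle 8 1; Segment 3];
  [:: Reeve 32 1; Reeve 31 1; Triangle 2 2; Segment 1];
  [:: Reeve 26 3; Reeve 26 3; Triangle 18 1; Segment 7];
  [:: Reeve 35 1; Reeve 13 2; Triangle 8 1; Segment 2];
  [:: Reeve 34 1; Reeve 12 2; Reeve 2 5];
  [:: Reeve 36 5; Reeve 9 9; Reeve 5 13]
].

(* Binary integers make the coefficients computable by [vm_compute]. *)
Definition coef_signs (bs : seq block) : seq BinNums.Z :=
  [seq Num.sg c | c <- blocks_coefs BinNums.Z bs].

(** The signs of the coefficients of degrees 0 to 9: entry [k] of [s] governs degree [k + 1], with
    [true] for negative, while degrees 0, 8 and 9 are positive. *)
Definition sign_row (s : seq bool) : seq BinNums.Z :=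
  1 :: [seq (-1) ^+ nat_of_bool b | b <- s] ++ [:: 1; 1].

Definition realizes_signs (s : seq bool) (bs : seq block) : bool :=
  [&& all block_valid bs, sumn (map block_dim bs) == 9
    & coef_signs bs == sign_row s].

(** A finite computation: for each of the 128 patterns of length 7, [has] looks for a row with valid
    blocks, total dimension 9 and the prescribed signs. *)
Lemma sign_table_complete :
  all (fun s => has (realizes_signs s) sign_table) (bool_seqs 7).
Proof. by vm_compute. Qed.

Theorem theorem6p8 (R : realType) (q : nat) (hq : (1 <= q)%N)
    (i : 'I_q -> nat)
    (hi : forall j : 'I_q, (1 <= i j)%N /\ (i j <= 7)%N)
    (hinc : forall j k : 'I_q, (j < k)%N -> (i j < i k)%N) :
  exists (N : nat) (P : set 'rV[R]_N) (p : {poly rat}),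
    [/\ integral_polytope P, has_dim P 9, is_ehrhart_polynomial P p,
        forall j : 'I_q, p`_(i j) < 0
      & forall k : nat, (k <= 9)%N -> (forall j : 'I_q, k <> i j) ->
          0 < p`_k].
Proof.
(* The pattern to look up: it marks the degrees from 1 to 7 that occur among the [i j]. *)
pose S := [seq [exists j, i j == k] | k <- iota 1 7].
have /(has_nthP [::])[l _ /and3P[]] : has (realizes_signs S) sign_table.
  exact: allP sign_table_complete S (mem_bool_seqs S).
move: (nth _ _ l) => bs bsv /eqP bs9 /eqP sgE.
have sgk k : (k <= 9)%N ->
    Num.sg (blocks_coefs BinNums.Z bs)`_k = (-1) ^+ [exists j, i j == k].
  (* Degrees 0, 8 and 9 are never among the [i j], in agreement with the fixed entries 1 of
     [sign_row]. *)
  have out r : (r == 0)%N || (7 < r)%N -> [exists j, i j == r] = false.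
    move=> r7; apply/existsP => -[j /eqP ijl].
    by have := hi j; rewrite ijl => -[]; lia.
  have -> : Num.sg (blocks_coefs BinNums.Z bs)`_k =
      (coef_signs bs)`_k.
    have [ks|ks] := ltnP k (size (blocks_coefs BinNums.Z bs)).
      by rewrite (nth_map 0).
    by rewrite !nth_default ?size_map ?sgr0.
  rewrite sgE; case: k => [|k] k9; first by rewrite out.
  rewrite /sign_row -[LHS]/(nth 0 (_ ++ _) k) nth_cat !size_map size_iota.
  case: ltnP => k7.
    rewrite (nth_map false) ?size_map ?size_iota //.
    by rewrite (nth_map 0%N) ?size_iota // nth_iota.
  (* The degree is now [k.+1], so these are the coefficients of degrees 8 and 9. *)
  have [->|->] : k = 7%N \/ k = 8%N by lia.
    by rewrite out.
  by rewrite out.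
have := ehrhart_polynomial_blocks R bsv.
rewrite bs9 => -[P [p [Pint Pdim Pp pneg ppos]]].
exists 9, P, p; split=> // [j|k k9 kj].
- have /existsP ex : exists l, i l == i j by exists j.
  have [_ i7] := hi j.
  by rewrite pneg -sgr_cp0 sgk ?ex ?expr1 // (leq_trans i7).
rewrite ppos -sgr_cp0 sgk // (_ : [exists j, _] = false) //.
by apply/existsP => -[j /eqP ik]; exact: (kj j).
Qed.
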